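(* Fix $P>0$. For each $K$ let $n_{\mathrm t}=n_{\mathrm t}(K)\ge1$ and $L=L(K)\ge1$ be integers, let $\mathbf H_{k,l}$, $k\in[K]$, $l\in[L]$, be i.i.d. $\mathcal{CN}(0,\mathrm I_{n_{\mathrm t}})$ random vectors, and let $$\bar R_0=\mathbb E\Big[\min_{k\in[K]}\frac1L\sum_{l=1}^L\ln\Big(1+\frac{P}{n_{\mathrm t}}\|\mathbf H_{k,l}\|^2\Big)\Big].$$ If $L\,n_{\mathrm t}\ge\ln(K)+O(1)$, then $\bar R_0=\Theta(1)$ as $K\to\infty$.
   Context: $[K]=\{1,\dots,K\}$; $\mathcal{CN}(0,\mathrm I_n)$ is the standard circularly symmetric complex Gaussian distribution on $\mathbb C^n$. $\bar R_0$ is the average multicast rate (in nats) with isotropic Gaussian signaling over $L$ parallel independent Rayleigh fading sub-channels. The condition $L n_{\mathrm t}\ge\ln(K)+O(1)$ means: there is a real constant $c_0$ with $L n_{\mathrm t}\ge\ln K+c_0$ for all sufficiently large $K$. $f(K)=\Theta(1)$ means that $|f(K)|$ is bounded above and bounded below away from $0$ for all sufficiently large $K$. *)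

(* Defs.v *)
From HB Require Import structures.
From mathcomp Require Import all_boot all_order all_algebra.
From mathcomp Require Import complex.
From mathcomp Require Import all_classical all_reals all_analysis.

Set Implicit Arguments.
Unset Strict Implicit.
Unset Printing Implicit Defensive.

Import Order.TTheory GRing.Theory Num.Theory.
Import numFieldNormedType.Exports.

Local Open Scope classical_set_scope.
Local Open Scope ring_scope.

(* Mutual independence of a finite family [G] of classes of events: the product
   rule holds for every subfamily [J]. *)
Definition mutually_independent (R : realType) (d : measure_display)
    (T : measurableType d) (Pr : probability T R) (I : finType)
    (G : I -> set (set T)) : Prop :=
  forall A : I -> set T, (forall i, G i (A i)) ->
  forall J : {set I},
    Pr (\bigcap_(i in [set` J]) A i) = (\prod_(i in J) Pr (A i))%E.

(* The 2n real coordinates of C^n: [(j, false)] is the real part of the j-th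
   entry, [(j, true)] its imaginary part. *)
Definition rcoord (R : realType) (n : nat) (jb : 'I_n * bool)
    (z : 'rV[R[i]]_n) : R :=
  if jb.2 then complex.Im (z ord0 jb.1) else complex.Re (z ord0 jb.1).

(* The Borel sigma-algebra of C^n = R^(2n), as the product of the Borel
   sigma-algebras of the coordinates. *)
Definition borel_cvec (R : realType) (n : nat) : set (set 'rV[R[i]]_n) :=
  <<s [set A | exists (jb : 'I_n * bool) (B : set R),
         measurable B /\ A = @rcoord R n jb @^-1` B] >>.

Definition random_cvec (R : realType) (d : measure_display)
    (T : measurableType d) (n : nat) (X : T -> 'rV[R[i]]_n) : Prop :=
  forall B, borel_cvec B -> measurable (X @^-1` B).

(* [X] has law CN(0, I_n): the real and imaginary parts of its entries are 2n
   mutually independent real Gaussians N(0, 1/2). The second parameter of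
   [normal_prob] is the standard deviation. *)
Definition std_complex_gaussian (R : realType) (d : measure_display)
    (T : measurableType d) (Pr : probability T R) (n : nat)
    (X : T -> 'rV[R[i]]_n) : Prop :=
  [/\ random_cvec X,
      forall (jb : 'I_n * bool) (B : set R), measurable B ->
        Pr ((rcoord jb \o X) @^-1` B) = normal_prob 0 (Num.sqrt 2^-1) B
    & mutually_independent Pr (fun jb : 'I_n * bool =>
        preimage_set_system [set: T] (rcoord jb \o X)
          (measurable : set (set R)))].

Definition iid_std_complex_gaussian (R : realType) (d : measure_display)
    (T : measurableType d) (Pr : probability T R) (K L n : nat)
    (H : 'I_K -> 'I_L -> T -> 'rV[R[i]]_n) : Prop :=
  (forall k l, std_complex_gaussian Pr (H k l)) /\
  mutually_independent Pr (fun kl : 'I_K * 'I_L =>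
    preimage_set_system [set: T] (H kl.1 kl.2) (@borel_cvec R n)).

Definition sqnorm (R : realType) (n : nat) (z : 'rV[R[i]]_n) : R :=
  \sum_(j < n) ComplexField.Normc.normc (z ord0 j) ^+ 2.

(* [min_k f k] over k in [K], the neutral element +oo being used only for
   K = 0 (where the value is then the junk value 0). *)
Definition min_ord (R : realType) (K : nat) (f : 'I_K -> R) : R :=
  fine (\big[Order.min/+oo%E]_(k < K) (f k)%:E).

Lemma min_ord_le (R : realType) (K : nat) (f : 'I_K -> R) (k : 'I_K) :
  min_ord f <= f k.
Proof.
have leb : (\big[Order.min/+oo]_(j < K) (f j)%:E <= (f k)%:E)%E.
  by rewrite (bigD1 k)//= ge_min lexx.
have : (\big[Order.min/+oo]_(j < K) (f j)%:E != -oo)%E.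
  by elim/big_ind : _ => // x y; rewrite minEle; case: ifP.
by rewrite /min_ord; case: (\big[_/_]_(_ < _) _) leb.
Qed.

Lemma min_ord_attained (R : realType) (K : nat) (f : 'I_K -> R) :
  (0 < K)%N -> exists k, min_ord f = f k.
Proof.
move=> K0.
suff : exists k, (\big[Order.min/+oo]_(j < K) (f j)%:E = (f k)%:E)%E.
  by move=> [k fk]; exists k; rewrite /min_ord fk.
suff [bE|//] : (\big[Order.min/+oo]_(j < K) (f j)%:E = +oo)%E \/
    exists k, (\big[Order.min/+oo]_(j < K) (f j)%:E = (f k)%:E)%E.
  have : (\big[Order.min/+oo]_(j < K) (f j)%:E <= (f (Ordinal K0))%:E)%E.
    by rewrite (bigD1 (Ordinal K0))//= ge_min lexx.
  by rewrite bE.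
elim/big_ind : _ => [|x y xE yE|k _]; [by left| |by right; exists k].
by rewrite minEle; case: ifP.
Qed.

(* The average multicast rate (in nats), as an extended real. *)
Definition avg_multicast_rate (R : realType) (d : measure_display)
    (T : measurableType d) (Pr : probability T R) (P : R) (K L n : nat)
    (H : 'I_K -> 'I_L -> T -> 'rV[R[i]]_n) : \bar R :=
  ('E_Pr[fun w => min_ord (fun k : 'I_K =>
     (L%:R^-1 * \sum_(l < L) ln (1 + P / n%:R * sqnorm (H k l w)))%R)])%E.

(* Both bounds are real numbers, so [f K] is finite for all large [K]. *)
Definition Theta1 (R : realType) (f : nat -> \bar R) : Prop :=
  exists c C : R, 0 < c /\
    \forall K \near \oo, (c%:E <= `|f K| /\ `|f K| <= C%:E)%E.

(* Main.v *)
(* Upper bound: the minimum is at most the rate of one user, and ln (1 + x) <= x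
   bounds its mean by a constant times P, the Gaussian coordinates having a
   finite second moment.

   Lower bound: fix a user and call one of its 2 L n_t real coordinates small
   when its absolute value is below r, an event of probability at most 2 r. If
   fewer than L n_t coordinates are small, then ln (1 + y) >= y / (1 + y) bounds
   the rate of that user below by c = P r^2 / (1 + 2 P r^2). By independence and
   a union bound over the sets of coordinates, at least L n_t coordinates of a
   given user are small with probability at most 4^(L n_t) (2 r)^(L n_t), which
   is exp (- 2 L n_t) for a suitable r. A union bound over the users leaves
   K exp (- 2 L n_t) <= exp (- 2 c0) / K, hence the mean of the minimum is at
   least c / 2 for large K. *)

Require Import Defs.
From HB Require Import structures.
From mathcomp Require Import all_boot all_order all_algebra.
From mathcomp Require Import complex.
From mathcomp Require Import all_classical all_reals all_analysis.
From mathcomp Require Import measurable_realfun ring lra.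

Set Implicit Arguments.
Unset Strict Implicit.
Unset Printing Implicit Defensive.

Import Order.TTheory GRing.Theory Num.Theory.
Import numFieldNormedType.Exports.
Import HBNNSimple.

Local Open Scope classical_set_scope.
Local Open Scope ring_scope.

(** * Union bound, integrals against a density, and the real Gaussian law *)

Lemma measure_bigsetU_le (d : measure_display) (T : measurableType d)
    (R : realType) (mu : {measure set T -> \bar R}) (I : Type) (s : seq I)
    (P : pred I) (F : I -> set T) : (forall i, measurable (F i)) ->
  (mu (\big[setU/set0]_(i <- s | P i) F i) <= \sum_(i <- s | P i) mu (F i))%E.
Proof.
move=> mF; elim: s => [|i s ih]; first by rewrite !big_nil measure0.
rewrite !big_cons; case: ifP => // _.
apply: le_trans (leeD2l _ ih); apply: measureU2 => //.
exact: bigsetU_measurable.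
Qed.

Lemma normal_prob_le (R : realType) (m s : R) (A : set R) :
  s != 0 -> measurable A ->
  (normal_prob m s A <= (normal_peak s)%:E * lebesgue_measure A)%E.
Proof.
move=> s0 mA; rewrite /normal_prob -integral_cst//.
apply: ge0_le_integral => //=.
- by move=> x _; rewrite lee_fin normal_pdf_ge0.
- apply/measurable_EFinP; apply: measurable_funTS.
  exact: measurable_normal_pdf.
- by move=> x _; rewrite lee_fin normal_pdf_ub.
Qed.

(** Here [g] is the density of [nu] with respect to [mu]. The integral of [f] is a supremum over
    simple functions below [f]; for each of them the density formula is a finite sum, and
    multiplying by [g] keeps it below [h]. *)
Lemma ge0_le_integral_density (d : measure_display) (T : measurableType d)
    (R : realType) (mu nu : {measure set T -> \bar R}) (g : T -> R)
    (f h : T -> \bar R) :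
  measurable_fun setT g -> (forall x, 0 <= g x) ->
  (forall A, measurable A -> nu A = (\int[mu]_(x in A) (g x)%:E)%E) ->
  (forall x, 0 <= f x)%E ->
  measurable_fun setT h ->
  (forall x, f x * (g x)%:E <= h x)%E ->
  (\int[nu]_x f x <= \int[mu]_x h x)%E.
Proof.
move=> mg g0 nuE f0 mh fgh.
rewrite ge0_integralTE//; apply: ge_ereal_sup => _ [u /= uf <-].
have -> : sintegral nu u = (\int[mu]_x ((u x)%:E * (g x)%:E))%E.
  rewrite sintegralE.
  under [RHS]eq_integral.
    move=> x _; rewrite fimfunE -fsumEFin// ge0_mule_fsuml; last first.
      by move=> r; rewrite EFinM nnfun_muleindic_ge0.
    over.
  rewrite ge0_integral_fsum//; last 2 first.
  - move=> r; apply/measurable_EFinP.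
    by apply: measurable_funM => //; exact: measurable_funM.
  - move=> r x _; apply: mule_ge0; last by rewrite lee_fin.
    by rewrite EFinM nnfun_muleindic_ge0.
  apply: eq_fsbigr => r; rewrite inE/= => -[x _ <-].
  rewrite nuE// [in LHS]integral_mkcond -ge0_integralZl//; last 3 first.
  - apply/(measurable_restrictT _ _).1 => //; apply/measurable_EFinP.
    exact: measurable_funTS.
  - by move=> y _; apply: erestrict_ge0 => z _; rewrite lee_fin.
  - by rewrite lee_fin.
  apply: eq_integral => y _; rewrite patchE indicE; case: ifP => _.
    by rewrite mulr1.
  by rewrite mulr0 mul0e mule0.
apply: ge0_le_integral => //.
- by move=> x _; rewrite mule_ge0// lee_fin.
- by apply/measurable_EFinP/measurable_funM.
- by move=> x _; apply: le_trans (fgh x); rewrite lee_wpmul2r// lee_fin.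
Qed.

(* The factor [x^2] is absorbed by doubling the variance. *)
Lemma normal_second_moment (R : realType) (s : R) : s != 0 ->
  exists C : R, (\int[normal_prob 0 s]_x (x ^+ 2)%:E <= C%:E)%E.
Proof.
move=> s0; pose t := s * Num.sqrt 2.
have t0 : t != 0 by rewrite mulf_neq0// gt_eqF// sqrtr_gt0.
have t2 : t ^+ 2 = s ^+ 2 *+ 2 by rewrite exprMn sqr_sqrtr// mulr_natr.
pose k := normal_peak t.
have k0 : 0 < k by exact: normal_peak_gt0.
(* The factor [s ^+ 2 * 4] turns the [y] introduced below into [x ^+ 2]; the rest is the ratio of
   the peaks of the two densities. *)
pose C := s ^+ 2 * 4 * normal_peak s / k.
have C0 : 0 <= C.
  rewrite divr_ge0 ?(ltW k0)// mulr_ge0 ?normal_peak_ge0//.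
  by rewrite mulr_ge0 ?sqr_ge0.
exists C.
apply: (@le_trans _ _
  (\int[lebesgue_measure]_x (C%:E * (normal_pdf 0 t x)%:E))%E); last first.
  rewrite ge0_integralZl//.
  - by rewrite integral_normal_pdf mule1.
  - by apply/measurable_EFinP; exact: measurable_normal_pdf.
  - by move=> x _; rewrite lee_fin normal_pdf_ge0.
apply: (@ge0_le_integral_density _ _ R lebesgue_measure (normal_prob 0 s)
  (normal_pdf 0 s) (fun x => (x ^+ 2)%:E)
  (fun x => C%:E * (normal_pdf 0 t x)%:E)%E).
- exact: measurable_normal_pdf.
- by move=> x; exact: normal_pdf_ge0.
- by [].
- by move=> x; rewrite lee_fin sqr_ge0.
- apply/measurable_EFinP; apply: measurable_funM => //.
  exact: measurable_normal_pdf.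
move=> x; rewrite -!EFinM lee_fin !normal_pdfE//= /normal_fun subr0.
rewrite t2 -/k.
(* With this [y], the exponents of the densities for [s] and [t] are [- y - y] and [- y]: one factor
   [e] is kept for the density with [t], the other absorbs [y]. *)
set y := x ^+ 2 / (s ^+ 2 * 4).
have s20 : s ^+ 2 != 0 by rewrite sqrf_eq0.
have -> : - x ^+ 2 / (s ^+ 2 *+ 2) = - y - y.
  by rewrite /y; field.
have -> : - x ^+ 2 / (s ^+ 2 *+ 2 *+ 2) = - y.
  by rewrite /y; field.
have -> : x ^+ 2 = y * (s ^+ 2 * 4) by rewrite /y; field.
rewrite expRD; set e := expR (- y).
have e0 : 0 < e by exact: expR_gt0.
have ye : y * e <= 1.
  rewrite /e expRN ler_pdivrMr ?expR_gt0// mul1r.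
  by apply: le_trans (expR_ge1Dx y); rewrite lerDr.
have -> : C * (k * e) = s ^+ 2 * 4 * normal_peak s * e * 1.
  by rewrite /C; field; rewrite gt_eqF.
have -> : y * (s ^+ 2 * 4) * (normal_peak s * (e * e)) =
  s ^+ 2 * 4 * normal_peak s * e * (y * e) by ring.
apply: ler_wpM2l ye; rewrite mulr_ge0 ?(ltW e0)// mulr_ge0 ?normal_peak_ge0//.
by rewrite mulr_ge0 ?sqr_ge0.
Qed.

(** * Squared norm and real coordinates of a complex Gaussian vector *)

Lemma sqnormE (R : realType) (n : nat) (z : 'rV[R[i]]_n) :
  sqnorm z = \sum_(jb : 'I_n * bool) rcoord jb z ^+ 2.
Proof.
rewrite -(pair_bigA _ (fun j b => rcoord (j, b) z ^+ 2)).
apply: eq_bigr => j _; rewrite big_bool /rcoord/=.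
case: (z ord0 j) => a b /=.
by rewrite sqr_sqrtr ?addr_ge0 ?sqr_ge0// addrC.
Qed.

Lemma sqnorm_ge0 (R : realType) (n : nat) (z : 'rV[R[i]]_n) : 0 <= sqnorm z.
Proof. by rewrite sqnormE sumr_ge0// => jb _; rewrite sqr_ge0. Qed.

Lemma borel_cvec_rcoord (R : realType) (n : nat) (jb : 'I_n * bool)
    (B : set R) : measurable B -> borel_cvec (rcoord jb @^-1` B).
Proof. by move=> mB; apply: sub_sigma_algebra; exists jb, B. Qed.

Lemma borel_cvec_bigcap (R : realType) (n : nat) (I : finType) (J : {set I})
    (F : I -> set 'rV[R[i]]_n) : (forall i, borel_cvec (F i)) ->
  borel_cvec (\bigcap_(i in [set` J]) F i).
Proof.
move=> bF.
have /(sigma_algebraP (fun X _ => @subsetT _ X))[bT _ _ bI] :=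
  @smallest_sigma_algebra _ setT [set A | exists (jb : 'I_n * bool) (B : set R),
    measurable B /\ A = @rcoord R n jb @^-1` B].
(* Enumerating [J] turns the intersection into a finite iteration, so that closure under binary
   intersections suffices. *)
have -> : [set` J] = [set` enum J].
  by apply/seteqP; split=> i /=; rewrite mem_enum.
by rewrite bigcap_seq; apply: big_ind.
Qed.

Lemma measurable_rcoord (R : realType) (d : measure_display)
    (T : measurableType d) (n : nat) (X : T -> 'rV[R[i]]_n)
    (jb : 'I_n * bool) :
  random_cvec X -> measurable_fun setT (rcoord jb \o X).
Proof.
move=> rX _ B mB; rewrite setTI; apply: (rX (rcoord jb @^-1` B)).
exact: borel_cvec_rcoord.
Qed.

Lemma measurable_sqnorm (R : realType) (d : measure_display)
    (T : measurableType d) (n : nat) (X : T -> 'rV[R[i]]_n) :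
  random_cvec X -> measurable_fun setT (fun w => sqnorm (X w)).
Proof.
move=> rX; under eq_fun do rewrite sqnormE.
apply: measurable_sum => jb; apply: measurable_funX.
exact: measurable_rcoord.
Qed.

Lemma sqrt_half_neq0 (R : realType) : Num.sqrt 2^-1 != 0 :> R.
Proof. by rewrite gt_eqF// sqrtr_gt0 invr_gt0. Qed.

(** Variance 1/2 gives the density the peak 1 / sqrt pi, which is at most 1, so the probability is
    at most the length of the interval. *)
Lemma gaussian_coord_small (R : realType) (d : measure_display)
    (T : measurableType d) (Pr : probability T R) (n : nat)
    (X : T -> 'rV[R[i]]_n) (jb : 'I_n * bool) (r : R) :
  std_complex_gaussian Pr X -> 0 < r ->
  (Pr ((rcoord jb \o X) @^-1` `](- r)%R, r[) <= (2 * r)%:E)%E.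
Proof.
move=> [_ law _] r0; rewrite law//.
have mI : measurable (`](- r)%R, r[%classic : set R) by [].
apply: le_trans (normal_prob_le 0 (@sqrt_half_neq0 R) mI) _.
rewrite lebesgue_measure_itv/= lte_fin gtrN// -EFinB -EFinM lee_fin.
rewrite opprK -mulr2n -(mulr_natl r) ler_piMl ?mulr_ge0 ?(ltW r0)//.
rewrite /normal_peak sqr_sqrtr ?invr_ge0// -mulr_natr.
rewrite [X in Num.sqrt X](_ : _ = pi); last by field.
rewrite invf_le1 ?sqrtr_gt0 ?pi_gt0//.
by rewrite -[leLHS]sqrtr1 ler_sqrt ?pi_ge0// (le_trans _ (pi_ge2 R))// ler1n.
Qed.

(** All [2 * n] coordinates have the same law, hence the same second moment; [C] is chosen before
    the dimension and the probability space, which vary with [K] later. *)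
Lemma gaussian_mean_sqnorm (R : realType) : exists C : R,
  forall (d : measure_display) (T : measurableType d) (Pr : probability T R)
    (n : nat) (X : T -> 'rV[R[i]]_n), std_complex_gaussian Pr X ->
  (\int[Pr]_w (sqnorm (X w))%:E <= (C * n%:R)%:E)%E.
Proof.
have [C HC] := normal_second_moment (@sqrt_half_neq0 R).
exists (C * 2) => d T Pr n X [rX law _].
under eq_integral do rewrite sqnormE -sumEFin.
rewrite ge0_integral_sum//; last 2 first.
- move=> jb; apply/measurable_EFinP; apply: measurable_funX.
  exact: measurable_rcoord.
- by move=> jb w _; rewrite lee_fin sqr_ge0.
apply: (@le_trans _ _ (\sum_(jb : 'I_n * bool) C%:E)%E).
  apply: lee_sum => jb _.
  apply: le_trans HC.
  have mX := measurable_rcoord jb rX.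
  (* [normal_prob] is a measure on [measurableTypeR R], whose display is not the
     one of the canonical measurable structure of [R]. *)
  pose Y : {RV Pr >-> measurableTypeR R} :=
    HB.pack (rcoord jb \o X : T -> measurableTypeR R)
      (isMeasurableFun.Build _ _ T (measurableTypeR R) _ mX).
  rewrite le_eqVlt; apply/orP; left; apply/eqP.
  transitivity (\int[distribution Pr Y]_x (x ^+ 2)%:E)%E.
    rewrite ge0_integral_distribution//.
      by apply/measurable_EFinP; exact: measurable_funX.
    by move=> x; rewrite lee_fin sqr_ge0.
  by apply: eq_measure_integral => A mA _; exact: law.
by rewrite sumEFin sumr_const card_prod card_ord card_bool -(mulr_natr C) natrM
  (mulrC n%:R) mulrA.
Qed.

(** * Deterministic lower bound for the rate of one user *)

(** This is ln (1 + u) <= u at u = - y / (1 + y), since 1 + u is then the inverse of 1 + y. *)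
Lemma ln1D_ge (R : realType) (y : R) : 0 <= y -> y / (1 + y) <= ln (1 + y).
Proof.
move=> y0; have y1 : 0 < 1 + y by rewrite ltr_pwDl.
rewrite -lerN2 -lnV ?posrE//.
set t := y / (1 + y).
have -> : (1 + y)^-1 = 1 + - t by rewrite /t; field; rewrite gt_eqF.
apply: le_ln1Dx; rewrite /t ltrN2 ltr_pdivrMr// mul1r.
by rewrite ltrDr.
Qed.

(** Every coordinate that is not small adds at least [r ^+ 2] to its squared norm. The resulting
    bound on each logarithm is linear in the number of such coordinates, so it can be summed over
    the sub-channels, however unevenly these coordinates are spread. *)
Lemma mean_ln_ge (R : realType) (P r : R) (n L : nat)
    (x : 'I_L -> 'I_n * bool -> R) :
  0 < P -> 0 < r -> (0 < n)%N -> (0 < L)%N ->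
  (#|[set i : 'I_L * ('I_n * bool) | (`|x i.1 i.2| < r)%R]%SET| < L * n)%N ->
  P * r ^+ 2 / (1 + 2 * P * r ^+ 2) <=
  L%:R^-1 * \sum_(l < L) ln (1 + P / n%:R * \sum_jb x l jb ^+ 2).
Proof.
move=> P0 r0 n0 L0 few.
have nR : 0 < n%:R :> R by rewrite ltr0n.
have LR : 0 < L%:R :> R by rewrite ltr0n.
(* [m l] counts the coordinates of sub-channel [l] that are not small. As [m l <= 2 * n], the
   denominator [1 + y] below never exceeds [D], which makes the bound linear in [m l]. *)
pose m l : R := \sum_jb (r <= `|x l jb|)%R%:R.
set D := 1 + 2 * P * r ^+ 2.
have D0 : 0 < D by rewrite ltr_pwDl// !mulr_ge0 ?sqr_ge0// ltW.
have m0 l : 0 <= m l by exact: sumr_ge0.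
have m2 l : m l <= 2 * n%:R.
  apply: (@le_trans _ _ (\sum_(jb : 'I_n * bool) 1)).
    by apply: ler_sum => jb _; rewrite lern1 leq_b1.
  by rewrite sumr_const card_prod card_ord card_bool mulnC natrM.
have lnge l : P * r ^+ 2 / n%:R / D * m l <=
    ln (1 + P / n%:R * \sum_jb x l jb ^+ 2).
  pose y := P / n%:R * (r ^+ 2 * m l).
  have y0 : 0 <= y by rewrite !mulr_ge0 ?sqr_ge0// ?invr_ge0 ltW.
  have yD : 1 + y <= D.
    rewrite lerD2l /y.
    have -> : 2 * P * r ^+ 2 = P / n%:R * (r ^+ 2 * (2 * n%:R)).
      by field; rewrite gt_eqF.
    by rewrite ler_wpM2l ?divr_ge0 ?(ltW P0)// ler_wpM2l ?sqr_ge0.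
  apply: (@le_trans _ _ (y / (1 + y))).
    have -> : P * r ^+ 2 / n%:R / D * m l = y / D.
      by rewrite /y; field; rewrite !gt_eqF.
    by rewrite ler_wpM2l// lef_pV2 ?posrE// ltr_pwDl.
  apply: le_trans (ln1D_ge y0) _.
  have yle : y <= P / n%:R * \sum_jb x l jb ^+ 2.
    rewrite ler_wpM2l ?divr_ge0 ?(ltW P0)// /m mulr_sumr.
    apply: ler_sum => jb _; have [rx|_] := leP r `|x l jb|.
      rewrite mulr1 -[leRHS]real_normK ?num_real//.
      by rewrite lerXn2r// nnegrE ?(ltW r0).
    by rewrite mulr0 sqr_ge0.
  by rewrite ler_ln ?posrE ?ltr_pwDl ?lerD2l// (le_trans y0 yle).
apply: (@le_trans _ _
  (L%:R^-1 * \sum_(l < L) (P * r ^+ 2 / n%:R / D * m l))); last first.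
  by rewrite ler_wpM2l ?invr_ge0// ler_sum.
rewrite -mulr_sumr.
(* Small and not small coordinates together number [2 * L * n], and fewer than half are small. *)
have big : L%:R * n%:R <= \sum_(l < L) m l.
  rewrite /m pair_bigA/=.
  have : \sum_(i : 'I_L * ('I_n * bool)) (r <= `|x i.1 i.2|)%R%:R +
      #|[set i : 'I_L * ('I_n * bool) | (`|x i.1 i.2| < r)%R]%SET|%:R =
      2 * (L%:R * n%:R) :> R.
    rewrite -sum1_card natr_sum [X in _ + X]big_mkcond -big_split/=.
    rewrite (eq_bigr (fun=> 1)); last first.
      by move=> i _; rewrite inE; case: leP => _; rewrite ?addr0 ?add0r.
    by rewrite sumr_const !card_prod !card_ord card_bool mulnA mulnC !natrM.
  have : #|[set i : 'I_L * ('I_n * bool) |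
      (`|x i.1 i.2| < r)%R]%SET|%:R <= L%:R * n%:R :> R.
    by rewrite -natrM ler_nat ltnW.
  by lra.
have -> : P * r ^+ 2 / D = L%:R^-1 * (P * r ^+ 2 / n%:R / D * (L%:R * n%:R)).
  by field; rewrite !gt_eqF.
rewrite ler_wpM2l ?invr_ge0// ler_wpM2l//.
by rewrite !mulr_ge0 ?sqr_ge0 ?invr_ge0// ltW.
Qed.

(** * Probability that a user has many small coordinates *)

Lemma lee_prod (R : realDomainType) (I : Type) (s : seq I) (P : pred I)
    (F G : I -> \bar R) : (forall i, P i -> (0 <= F i <= G i)%E) ->
  (\prod_(i <- s | P i) F i <= \prod_(i <- s | P i) G i)%E.
Proof.
move=> FG; suff /andP[] : (0 <= \prod_(i <- s | P i) F i
    <= \prod_(i <- s | P i) G i)%E by [].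
elim/big_ind2 : _ => [|x1 x2 y1 y2 /andP[x0 x12] /andP[y0 y12]|i /FG//].
  by rewrite lee01 lexx.
by rewrite mule_ge0// lee_pmul.
Qed.

(** Independence is used at two levels: first between the vectors [H k l], then between the
    coordinates of each vector. *)
Lemma small_coords_prob (R : realType) (d : measure_display)
    (T : measurableType d) (Pr : probability T R) (K L n : nat)
    (H : 'I_K -> 'I_L -> T -> 'rV[R[i]]_n) (k : 'I_K) (r : R)
    (J : {set 'I_L * ('I_n * bool)}) :
  iid_std_complex_gaussian Pr H -> 0 < r ->
  (Pr (\bigcap_(i in [set` J])
    ((rcoord i.2 \o H k i.1) @^-1` `](- r)%R, r[)) <= ((2 * r) ^+ #|J|)%:E)%E.
Proof.
move=> [gauss indep] r0.
have mI : measurable (`](- r)%R, r[%classic : set R) by [].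
pose Jl l := [set jb | (l, jb) \in J]%SET.
pose B l : set 'rV[R[i]]_n :=
  \bigcap_(jb in [set` Jl l]) (rcoord jb @^-1` `](- r)%R, r[).
have bB l : borel_cvec (B l).
  by apply: borel_cvec_bigcap => jb; exact: borel_cvec_rcoord.
(* The coordinates in [J] are grouped by sub-channel: one event [B l] per vector of user [k]. *)
have -> : \bigcap_(i in [set` J]) ((rcoord i.2 \o H k i.1) @^-1` `](- r)%R, r[)
    = \bigcap_(kl in [set` [set kl : 'I_K * 'I_L | kl.1 == k]%SET])
        (H kl.1 kl.2 @^-1` B kl.2).
  apply/seteqP; split=> w /= Hw.
    move=> [k' l]; rewrite /= inE/= => /eqP -> jb /=; rewrite inE => lJ.
    exact: (Hw (l, jb)).
  move=> [l jb] lJ; apply: (Hw (k, l)); rewrite /= inE//=.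
rewrite (indep (fun kl => H kl.1 kl.2 @^-1` B kl.2)); last first.
  by move=> [k' l]; exists (B l) => //; rewrite setTI.
have PB l : (Pr (H k l @^-1` B l) <= \prod_(jb in Jl l) (2 * r)%:E)%E.
  have [_ _ ind] := gauss k l.
  have -> : H k l @^-1` B l = \bigcap_(jb in [set` Jl l])
     ((rcoord jb \o H k l) @^-1` `](- r)%R, r[) by [].
  rewrite (ind (fun jb => (rcoord jb \o H k l) @^-1` `](- r)%R, r[)).
  2: by move=> jb; exists `](- r)%R, r[%classic => //; rewrite setTI.
  apply: lee_prod => jb _; rewrite measure_ge0/=.
  exact: gaussian_coord_small.
rewrite (eq_bigl (fun kl => (kl.1 == k) && true)); last first.
  by move=> kl; rewrite inE andbT.
rewrite -(pair_big (pred1 k) xpredT (fun k' l => Pr (H k' l @^-1` B l)))/=.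
rewrite big_pred1_eq.
(* Merging the products over the slices [Jl l] gives back one factor [2 * r] per element of [J]. *)
apply: (@le_trans _ _ (\prod_l \prod_(jb in Jl l) (2 * r)%:E)%E).
  by apply: lee_prod => l _; rewrite measure_ge0/=.
rewrite pair_big_dep/= prodEFin.
rewrite (eq_bigl (mem J)); last by move=> [l jb]; rewrite inE.
by rewrite prodr_const.
Qed.

(** The exceptional event is a union over the users and the sets of at least [L * n] coordinates.
    There are at most [K * 4 ^ (L * n)] such pairs. *)
Lemma few_small_coords_prob (R : realType) (d : measure_display)
    (T : measurableType d) (Pr : probability T R) (K L n : nat)
    (H : 'I_K -> 'I_L -> T -> 'rV[R[i]]_n) (r : R) :
  iid_std_complex_gaussian Pr H -> 0 < r -> 2 * r <= 1 ->
  exists B : set T, [/\ measurable B,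
    (Pr B <= (K%:R * (4 * (2 * r)) ^+ (L * n))%:E)%E &
    forall w, ~ B w -> forall k,
      (#|[set i : 'I_L * ('I_n * bool) |
          (`|rcoord i.2 (H k i.1 w)| < r)%R]%SET| < L * n)%N].
Proof.
move=> Hiid r0 r1.
pose F (kJ : 'I_K * {set 'I_L * ('I_n * bool)}) : set T :=
  \bigcap_(i in [set` kJ.2]) ((rcoord i.2 \o H kJ.1 i.1) @^-1` `](- r)%R, r[).
have mF kJ : measurable (F kJ).
  apply: fin_bigcap_measurable; first exact: finite_finset.
  move=> i _; have [rH _ _] := Hiid.1 kJ.1 i.1.
  by rewrite -[X in measurable X]setTI; apply: measurable_rcoord.
exists (\big[setU/set0]_(kJ : 'I_K * {set 'I_L * ('I_n * bool)} |
  (L * n <= #|kJ.2|)%N) F kJ); split.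
- exact: bigsetU_measurable.
- apply: le_trans (measure_bigsetU_le _ _ _ mF) _.
  apply: (@le_trans _ _ (\sum_(kJ : 'I_K * {set 'I_L * ('I_n * bool)})
      ((2 * r) ^+ (L * n))%:E)%E).
    rewrite [leLHS]big_mkcond/=; apply: lee_sum => kJ _.
    case: ifPn => [leJ|_]; last by rewrite lee_fin exprn_ge0// mulr_ge0// ltW.
    (* As [2 * r <= 1], a larger set [J] only lowers the bound. *)
    apply: le_trans (small_coords_prob _ _ Hiid r0) _.
    by rewrite lee_fin ler_wiXn2l// mulr_ge0// ltW.
  rewrite sumEFin sumr_const card_prod card_ord lee_fin -[leLHS]mulr_natl natrM.
  have -> : #|{: {set 'I_L * ('I_n * bool)}}| = (4 ^ (L * n))%N.
    rewrite -cardsT -powersetT card_powerset cardsT !card_prod !card_ord.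
    by rewrite card_bool mulnA mulnC expnM.
  by rewrite natrX -mulrA -exprMn.
- move=> w nB k; rewrite ltnNge; apply/negP => le; apply: nB.
  (* The set of all small coordinates of user [k] at [w] is itself one of the sets in the union. *)
  set S := [set i : 'I_L * ('I_n * bool) |
    (`|rcoord i.2 (H k i.1 w)| < r)%R]%SET in le.
  rewrite -(bigcup_pred [pred kJ : 'I_K * {set 'I_L * ('I_n * bool)} |
    (L * n <= #|kJ.2|)%N] F).
  exists (k, S) => //= i; rewrite /= inE/= in_itv/= => ir.
  by rewrite -ltr_norml.
Qed.

(** * Measurability and pointwise bounds for the rates *)

Lemma measurable_min_ord (R : realType) (d : measure_display)
    (T : measurableType d) (K : nat) (f : 'I_K -> T -> R) :
  (forall k, measurable_fun setT (f k)) ->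
  measurable_fun setT (fun w => min_ord (f ^~ w)).
Proof.
move=> mf; apply: (measurableT_comp (fine_measurable _)) => //.
elim: (index_enum _) => [|k s ih].
  by under eq_fun do rewrite big_nil; exact: measurable_cst.
under eq_fun do rewrite big_cons.
by apply: measurable_mine => //; apply/measurable_EFinP.
Qed.

Lemma min_ord_ge (R : realType) (K : nat) (f : 'I_K -> R) (c : R) :
  (0 < K)%N -> (forall k, c <= f k) -> c <= min_ord f.
Proof. by move=> K0 cf; have [k ->] := min_ord_attained f K0. Qed.

(** Convertible with the expression minimised in [avg_multicast_rate], so bounds on it apply there
    directly. *)
Definition user_rate (R : realType) (P : R) (L n : nat)
    (z : 'I_L -> 'rV[R[i]]_n) : R :=
  L%:R^-1 * \sum_(l < L) ln (1 + P / n%:R * sqnorm (z l)).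

Lemma measurable_user_rate (R : realType) (d : measure_display)
    (T : measurableType d) (P : R) (L n : nat)
    (X : 'I_L -> T -> 'rV[R[i]]_n) :
  (forall l, random_cvec (X l)) ->
  measurable_fun setT (fun w => user_rate P (X ^~ w)).
Proof.
move=> rX; apply: measurable_funM => //; apply: measurable_sum => l.
apply: (measurableT_comp (@measurable_ln R)).
apply: measurable_funD => //; apply: measurable_funM => //.
exact: measurable_sqnorm.
Qed.

Lemma user_rate_ge0 (R : realType) (P : R) (L n : nat)
    (z : 'I_L -> 'rV[R[i]]_n) : 0 <= P -> 0 <= user_rate P z.
Proof.
move=> P0; rewrite mulr_ge0 ?invr_ge0// sumr_ge0// => l _.
by rewrite ln_ge0// lerDl mulr_ge0 ?sqnorm_ge0// divr_ge0.
Qed.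

Lemma user_rate_le (R : realType) (P : R) (L n : nat)
    (z : 'I_L -> 'rV[R[i]]_n) : 0 <= P ->
  user_rate P z <= P / (L * n)%:R * \sum_(l < L) sqnorm (z l).
Proof.
move=> P0; have -> : P / (L * n)%:R = L%:R^-1 * (P / n%:R).
  by rewrite natrM invfM mulrCA.
rewrite -mulrA ler_wpM2l ?invr_ge0// mulr_sumr ler_sum// => l _.
apply: le_ln1Dx; apply: (@lt_le_trans _ _ 0); first by rewrite ltrN10.
by rewrite mulr_ge0 ?sqnorm_ge0// divr_ge0.
Qed.

(** * Bounds on the mean, and the asymptotic statement *)

Lemma avg_multicast_rate_le (R : realType) (P C : R) (d : measure_display)
    (T : measurableType d) (Pr : probability T R) (K L n : nat)
    (H : 'I_K -> 'I_L -> T -> 'rV[R[i]]_n) :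
  0 <= P -> (0 < K)%N -> (0 < L)%N -> (0 < n)%N ->
  (forall k l, random_cvec (H k l)) ->
  (forall k l, (\int[Pr]_w (sqnorm (H k l w))%:E <= (C * n%:R)%:E)%E) ->
  (avg_multicast_rate Pr P H <= (P * C)%:E)%E.
Proof.
move=> P0 K0 L0 n0 rH HC; pose k := Ordinal K0.
have PLn : 0 <= P / (L * n)%:R by rewrite divr_ge0.
have msq l : measurable_fun setT (fun w => (sqnorm (H k l w))%:E).
  by apply/measurable_EFinP; exact: measurable_sqnorm.
rewrite /avg_multicast_rate unlock.
apply: (@le_trans _ _ (\int[Pr]_w ((P / (L * n)%:R)%:E *
    \sum_(l < L) (sqnorm (H k l w))%:E))%E).
  apply: ge0_le_integral => //.
  - move=> w _; rewrite lee_fin; apply: min_ord_ge => // k'.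
    exact: (@user_rate_ge0 _ _ _ _ (H k' ^~ w)).
  - apply/measurable_EFinP; apply: measurable_min_ord => k'.
    exact: measurable_user_rate.
  - by apply: measurable_funeM; apply: emeasurable_sum => l.
  - move=> w _; rewrite sumEFin -EFinM lee_fin.
    apply: le_trans (min_ord_le _ k) _.
    exact: (@user_rate_le _ _ _ _ (H k ^~ w)).
rewrite ge0_integralZl//; last 2 first.
- by apply: emeasurable_sum => l.
- by move=> w _; apply: sume_ge0 => l _; rewrite lee_fin sqnorm_ge0.
rewrite ge0_integral_sum//; last first.
  by move=> l w _; rewrite lee_fin sqnorm_ge0.
apply: (@le_trans _ _ ((P / (L * n)%:R)%:E * \sum_(l < L) (C * n%:R)%:E)%E).
  by rewrite lee_wpmul2l ?lee_fin// lee_sum.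
rewrite sumEFin sumr_const card_ord -EFinM lee_fin -(mulr_natr (C * n%:R)).
rewrite natrM le_eqVlt; apply/orP; left; apply/eqP; field.
by rewrite !pnatr_eq0 -!lt0n L0 n0.
Qed.

(** The rates being nonnegative, their minimum dominates [c] times the indicator of the complement
    of [B]. *)
Lemma avg_multicast_rate_ge (R : realType) (P c : R) (d : measure_display)
    (T : measurableType d) (Pr : probability T R) (K L n : nat)
    (H : 'I_K -> 'I_L -> T -> 'rV[R[i]]_n) (B : set T) :
  0 <= P -> 0 <= c -> (0 < K)%N -> (forall k l, random_cvec (H k l)) ->
  measurable B ->
  (forall w, ~ B w -> forall k, c <= user_rate P (H k ^~ w)) ->
  (c%:E * (1 - Pr B) <= avg_multicast_rate Pr P H)%E.
Proof.
move=> P0 c0 K0 rH mB cB.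
rewrite /avg_multicast_rate unlock -probability_setC//.
have mC : measurable (~` B) by exact: measurableC.
rewrite -[X in Pr X]setIT -integral_indic// -ge0_integralZl//; last first.
  by apply/measurable_EFinP; exact: measurable_indic.
apply: ge0_le_integral => //.
- by move=> w _; rewrite mule_ge0 ?lee_fin.
- by apply/measurable_funeM/measurable_EFinP; exact: measurable_indic.
- apply/measurable_EFinP; apply: measurable_min_ord => k.
  exact: measurable_user_rate.
- move=> w _; rewrite -EFinM lee_fin; apply: min_ord_ge => // k.
  rewrite indicE; have [|_] := boolP (w \in _).
    by rewrite inE mulr1 => /cB; exact.
  by rewrite mulr0; exact: (@user_rate_ge0 _ _ _ _ (H k ^~ w)).
Qed.

Theorem proposition2 (R : realType) (P : R) (P_gt0 : 0 < P)
    (nt L : nat -> nat)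
    (nt_ge1 : forall K, (1 <= K)%N -> (1 <= nt K)%N)
    (L_ge1 : forall K, (1 <= K)%N -> (1 <= L K)%N)
    (d : nat -> measure_display) (Omega : forall K, measurableType (d K))
    (Pr : forall K, probability (Omega K) R)
    (H : forall K, 'I_K -> 'I_(L K) -> Omega K -> 'rV[R[i]]_(nt K))
    (H_iid : forall K, iid_std_complex_gaussian (Pr K) (H K))
    (L_nt_ge : exists c0 : R,
       \forall K \near \oo, ln (K%:R) + c0 <= (L K)%:R * (nt K)%:R) :
  Theta1 (fun K => avg_multicast_rate (Pr K) P (H K)).
Proof.
have [C HC] := gaussian_mean_sqnorm R.
have [c0 Hc0] := L_nt_ge.
(* [r] makes [4 * (2 * r) = exp (-2)]. *)
pose r : R := expR (- 2) / 8.
have r0 : 0 < r by rewrite divr_gt0// expR_gt0.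
have r4 : 4 * (2 * r) = expR (- 2) by rewrite /r; field.
have r1 : 2 * r <= 1.
  have : expR (- 2) <= 1 :> R by rewrite -[leRHS]expR0 ler_expR oppr_le0.
  by rewrite -r4; lra.
pose c : R := P * r ^+ 2 / (1 + 2 * P * r ^+ 2).
have c_gt0 : 0 < c.
  by rewrite divr_gt0 ?mulr_gt0 ?exprn_gt0// addr_gt0// !mulr_gt0// exprn_gt0.
exists (c / 2), (P * C); split; first by rewrite divr_gt0.
near=> K.
have K0 : (0 < K)%N by near: K; exact: nbhs_infty_gt.
(* This threshold is what makes the final bound exp (- 2 c0) / K on the exceptional event at most
   1/2. *)
have K2 : 2 * expR (- (2 * c0)) <= K%:R by near: K; exact: nbhs_infty_ger.
have KL : ln K%:R + c0 <= (L K)%:R * (nt K)%:R by near: K.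
have rH k l : random_cvec (H K k l) by have [] := (H_iid K).1 k l.
have n0 := nt_ge1 _ K0; have L0 := L_ge1 _ K0.
have [B [mB PB HB]] := few_small_coords_prob (H_iid K) r0 r1.
have lower : ((c / 2)%:E <= avg_multicast_rate (Pr K) P (H K))%E.
  apply: (@le_trans _ _ (c%:E * (1 - Pr K B))%E); last first.
    apply: avg_multicast_rate_ge => //; [exact: ltW|exact: ltW|].
    move=> w nB k.
    have := @mean_ln_ge _ P r _ _ (fun l jb => rcoord jb (H K k l w))
      P_gt0 r0 n0 L0 (HB _ nB k).
    by rewrite /user_rate; under eq_bigr do rewrite -sqnormE.
  have PB2 : (Pr K B <= (2^-1)%:E)%E.
    apply: le_trans PB _; rewrite r4 lee_fin -expRM_natl natrM.
    have KR : 0 < K%:R :> R by rewrite ltr0n.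
    (* By [KL], the exponent -2 L n_t is at most -2 ln K - 2 c0; the inverse square of [K] outweighs
       the factor [K] of the union bound. *)
    apply: (@le_trans _ _ (K%:R * (K%:R ^- 2 * expR (- (2 * c0))))).
      rewrite ler_wpM2l// -{1}[K%:R]lnK ?posrE//.
      rewrite -exprVn -expRN -expRM_natl -expRD.
      by rewrite ler_expR; lra.
    rewrite [leLHS](_ : _ = expR (- (2 * c0)) / K%:R); last first.
      by field; rewrite gt_eqF.
    by rewrite ler_pdivrMr//; lra.
  rewrite EFinM lee_wpmul2l ?lee_fin ?(ltW c_gt0)//.
  rewrite leeBrDr; last by rewrite fin_num_measure.
  apply: le_trans (leeD2l _ PB2) _.
  by rewrite -EFinD lee_fin; lra.
have avg0 : (0 <= avg_multicast_rate (Pr K) P (H K))%E.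
  by apply: le_trans lower; rewrite lee_fin divr_ge0// ltW.
rewrite gee0_abs//; split => //.
apply: avg_multicast_rate_le => //; first exact: ltW.
by move=> k l; apply: HC; exact: (H_iid K).1.
Unshelve. all: by end_near. Qed.
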